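(* Let $k,n,m\ge1$ be integers. For $\alpha=(\alpha_1,\ldots,\alpha_m)\in\mathbb{N}^m$ let $D_\alpha(k,n,m)$ be the number of plane partitions $\pi\in\mathrm{PP}(k,n,m)$ with exactly $\alpha_i$ descents of entry $i$ for each $i\in\{1,\ldots,m\}$; equivalently, such that for each $i\in\{1,\ldots,m\}$ the entry $i$ appears in exactly $\alpha_i$ columns of $\pi$. Then: (i) (symmetry) $D_\alpha(k,n,m)$ does not change under permutations of $(\alpha_1,\ldots,\alpha_m)$. (ii) (monotonicity) For $\alpha,\beta\in\mathbb{N}^m$ with $\beta\succeq\alpha$ and $|\alpha|=|\beta|$, one has $D_\alpha(k,n,m)\ge D_\beta(k,n,m)$.
   Context: $\mathbb{N}=\{0,1,2,\ldots\}$ and $|\alpha|=\alpha_1+\cdots+\alpha_m$. A plane partition $\pi=(\pi_{ij})_{i,j\ge1}$ is a two-dimensional array of nonnegative integers with finitely many nonzero entries such that $\pi_{ij}\ge\pi_{i+1\,j}$ and $\pi_{ij}\ge\pi_{i\,j+1}$ for all $i,j\ge1$ ($i$ is the row index, $j$ the column index). $\mathrm{PP}(k,n,m)$ is the set of plane partitions whose first row has at most $k$ nonzero entries, whose first column has at most $n$ nonzero entries, and whose first entry $\pi_{11}$ is at most $m$. A descent of entry $i$ in $\pi$ is a cell $(r,j)$ with $\pi_{rj}=i>\pi_{r+1\,j}$. For $\alpha,\beta\in\mathbb{N}^m$ we write $\beta\succeq\alpha$ ($\beta$ dominates $\alpha$) if $\sum_{i=1}^{\ell}\beta_i\ge\sum_{i=1}^{\ell}\alpha_i$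 for all $\ell\in\{1,\ldots,m\}$.
   Formalization: In (ii), α is additionally assumed nonincreasing (β arbitrary); without this (ii) is false: for k=1, n=m=2, α=(0,2), β=(1,1), β dominates α with |α|=|β|, but D_α=0 < D_β=1. *)

(* Defs.v *)
From mathcomp Require Import all_boot all_fingroup finmap.
From mathcomp Require Import boolp classical_sets functions cardinality.

Set Implicit Arguments.
Unset Strict Implicit.
Unset Printing Implicit Defensive.

Local Open Scope fset_scope.
Local Open Scope nat_scope.

(* Arrays with finitely many nonzero entries; [a (i, j)] is the entry in row
   i.+1 and column j.+1. *)
Definition array := {fsfun nat * nat -> nat with 0}.

Definition plane_partition (a : array) : Prop :=
  forall i j, a (i.+1, j) <= a (i, j) /\ a (i, j.+1) <= a (i, j).

Definition first_row_length (a : array) : nat :=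
  #|` [fset c in finsupp a | c.1 == 0]|.

Definition first_col_length (a : array) : nat :=
  #|` [fset c in finsupp a | c.2 == 0]|.

Definition PP (k n m : nat) : set array :=
  [set a | [/\ plane_partition a, first_row_length a <= k,
               first_col_length a <= n & a (0, 0) <= m]]%classic.

(* Used only for v > 0, so that restricting to the support loses nothing. *)
Definition descents (a : array) (v : nat) : nat :=
  #|` [fset c in finsupp a | (a c == v) && (a (c.1.+1, c.2) < v)]|.

Definition columns_containing (a : array) (v : nat) : nat :=
  #|` [fset c.2 | c in finsupp a & a c == v]|.

(* The index t : 'I_m stands for the entry t.+1.  [fset_set] would be empty on
   an infinite set; see [finite_PP]. *)
Definition PP_descents (k n m : nat) (alpha : 'I_m -> nat) : set array :=
  (PP k n m `&`
     [set a | forall t : 'I_m, descents a t.+1 = alpha t])%classic.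

Definition D (k n m : nat) (alpha : 'I_m -> nat) : nat :=
  #|` fset_set (PP_descents k n alpha)|.

Definition weight (m : nat) (alpha : 'I_m -> nat) : nat := \sum_(t < m) alpha t.

Definition dominates (m : nat) (beta alpha : 'I_m -> nat) : Prop :=
  forall l, 1 <= l <= m ->
    \sum_(t < m | t < l) alpha t <= \sum_(t < m | t < l) beta t.

Lemma plane_partition_le (a : array) i j i' j' :
  plane_partition a -> i <= i' -> j <= j' -> a (i', j') <= a (i, j).
Proof.
move=> pa /subnKC <- /subnKC <-.
elim: (i' - i) => [|d IH]; last by rewrite addnS (leq_trans (proj1 (pa _ _))).
rewrite addn0; elim: (j' - j) => [|d IH]; first by rewrite addn0.
by rewrite addnS (leq_trans (proj2 (pa _ _))).
Qed.

Lemma descents_columns (a : array) v :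
  plane_partition a -> 0 < v -> descents a v = columns_containing a v.
Proof.
move=> pa v0; rewrite /descents /columns_containing.
set A := [fset c in _ | _]; set B := [fset _ | _ in _ & _].
suff -> : B = [fset c.2 | c in A].
  rewrite [RHS]card_in_imfset // => -[i j] [i' j']; rewrite !inE/=.
  move=> /and3P[_ /eqP e l] /and3P[_ /eqP e' l'] ejj; rewrite -{}ejj in e' l' *.
  case: (ltngtP i i') => [ii|ii|-> //].
    by have := plane_partition_le pa ii (leqnn j); rewrite e' leqNgt l.
  by have := plane_partition_le pa ii (leqnn j); rewrite e leqNgt l'.
apply/fsetP => j; apply/imfsetP/imfsetP => /= -[c].
  rewrite !inE/= => /andP[_ /eqP ac] jc.
  have acj : a (c.1, j) = v by rewrite jc -surjective_pairing.
  have exP : exists i, a (i, j) == v by exists c.1; rewrite acj.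
  have ubP i : a (i, j) == v -> i <= \sum_(d <- finsupp a) d.1.
    move=> /eqP ai; have h : (i, j) \in finsupp a.
      by rewrite mem_finsupp ai -lt0n.
    by rewrite (big_fsetD1 _ h)/= leq_addr.
  have [i /eqP ai imax] := ex_maxnP exP ubP.
  exists (i, j) => //; rewrite !inE/= mem_finsupp ai eqxx -lt0n v0/=.
  rewrite ltn_neqAle -{2}ai (proj1 (pa _ _)) andbT.
  by apply/negP => /imax; rewrite ltnn.
by rewrite !inE => /and3P[h e _] ->; exists c; rewrite // !inE h e.
Qed.

Lemma PP_box k n m (a : array) i j :
  PP k n m a -> a (i, j) != 0 -> [/\ i < n, j < k & a (i, j) <= m].
Proof.
move=> [pa ra ca ma] aij; split; last first.
- exact: leq_trans (plane_partition_le pa (leq0n i) (leq0n j)) ma.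
- apply: leq_trans ra; rewrite -(size_iota 0 j.+1).
  rewrite -(size_map (fun t => (0, t))).
  apply: uniq_leq_size; first by rewrite map_inj_uniq ?iota_uniq// => ? ? [].
  move=> _ /mapP[t tj ->]; rewrite !inE/= andbT mem_finsupp -lt0n.
  rewrite mem_iota/= add0n ltnS in tj.
  by apply: leq_trans (plane_partition_le pa (leq0n i) tj); rewrite lt0n.
- apply: leq_trans ca; rewrite -(size_iota 0 i.+1).
  rewrite -(size_map (fun t => (t, 0))).
  apply: uniq_leq_size; first by rewrite map_inj_uniq ?iota_uniq// => ? ? [].
  move=> _ /mapP[t ti ->]; rewrite !inE/= andbT mem_finsupp -lt0n.
  rewrite mem_iota/= add0n ltnS in ti.
  by apply: leq_trans (plane_partition_le pa ti (leq0n j)); rewrite lt0n.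
Qed.

Lemma finite_PP k n m : finite_set (PP k n m).
Proof.
pose box : {fset nat * nat} := 
    [fset c in [seq (i, j) | i <- iota 0 n, j <- iota 0 k]].
pose g (f : {ffun 'I_n * 'I_k -> 'I_m.+1}) : array :=
  [fsfun c in box =>
    (if insub c.1 is Some i then
      if insub c.2 is Some j then f (i, j) : nat else 0 else 0) | 0].
apply: (@sub_finite_set _ _ (range g)); last first.
  by apply: finite_image; exact: finite_finset.
move=> a ppa; exists [ffun c => inord (a (val c.1, val c.2))] => //.
apply/fsfunP => -[i j]; rewrite fsfun_ffun.
have [a0|a0] := eqVneq (a (i, j)) 0.
  case: insubP => //= u _ ->/=; case: insubP => //= i' _ ei.
  by case: insubP => //= j' _ ej; rewrite ffunE/= ei ej a0 inordK.
have [ilt jlt am] := PP_box ppa a0.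
case: insubP => /= [u _ ->/=|/negP[]].
  rewrite (insubT (fun x => x < n) ilt) (insubT (fun x => x < k) jlt)/=.
  by rewrite ffunE/= inordK.
by rewrite !inE/= allpairs_f// mem_iota.
Qed.

Lemma finite_PP_descents k n m (alpha : 'I_m -> nat) :
  finite_set (PP_descents k n alpha).
Proof. exact: sub_finite_set (@subIsetl _ _ _) (finite_PP k n m). Qed.

(* The same count, with descents replaced by columns containing the entry. *)
Lemma D_columns k n m (alpha : 'I_m -> nat) :
  D k n alpha = #|` fset_set (PP k n m `&`
    [set a | forall t : 'I_m, columns_containing a t.+1 = alpha t])%classic|.
Proof.
congr (#|` fset_set _|); apply/seteqP.
by split=> a [ppa ha]; split=> // t; move: (ha t); rewrite descents_columns//;
  case: ppa.
Qed.

Definition nonincreasing (m : nat) (alpha : 'I_m -> nat) : Prop :=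
  forall i j : 'I_m, i <= j -> alpha j <= alpha i.

(* Monotonicity in the dominance order fails for an unsorted alpha: here
   alpha = (0, 2), beta = (1, 1), and D_alpha = 0 < D_beta. *)
Lemma monotonicity_fails_unsorted :
  let alpha (t : 'I_2) := if t == 0 :> nat then 0 else 2 in
  let beta (t : 'I_2) := 1 in
  [/\ dominates beta alpha, weight alpha = weight beta &
      D 1 2 alpha < D 1 2 beta].
Proof.
move=> alpha beta; split.
- move=> l; rewrite !(big_mkcond (fun t : 'I_2 => t < l)).
  by rewrite !big_ord_recl !big_ord0; case: l => [|[|[|l]]].
- by rewrite /weight !big_ord_recl !big_ord0.
suff [e0 [a pa]] : PP_descents 1 2 alpha = set0 /\
    exists a, PP_descents 1 2 beta a.
  rewrite /D e0 fset_set0 cardfs0 cardfs_gt0; apply/fset0Pn; exists a.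
  by rewrite in_fset_set ?mem_set//; exact: finite_PP_descents.
split.
  apply/seteqP; split=> // a [ppa /(_ (@Ordinal 2 1 isT))].
  case: (ppa) => pa _ _ _; rewrite descents_columns//= /alpha/= => h.
  suff : columns_containing a 2 <= 1 by rewrite h.
  rewrite -(cardfs1 0); apply: fsubset_leq_card; apply/fsubsetP => x.
  move=> /imfsetP[/= -[i j]]; rewrite !inE/= => /andP[+ _] ->.
  by rewrite mem_finsupp => /(PP_box ppa)[_ + _]; case: j.
pose col : {fset nat * nat} := [fset (0, 0); (1, 0)].
pose a : array := [fsfun c in col => 2 - c.1 | 0].
have aE i j : a (i, j) = if (j == 0) && (i < 2) then 2 - i else 0.
  by rewrite fsfun_fun !inE !xpair_eqE; case: i j => [|[|i]] [|j].
have sE : finsupp a = col.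
  apply/fsetP => -[i j]; rewrite mem_finsupp aE !inE !xpair_eqE.
  by case: i j => [|[|i]] [|j].
have pa : plane_partition a.
  by move=> i j; rewrite !aE; case: i j => [|[|i]] [|j].
have cle (P : nat * nat -> bool) x :
    (forall c, c \in col -> P c -> c = x) -> #|` [fset c in col | P c]| <= 1.
  move=> h; rewrite -(cardfs1 x); apply: fsubset_leq_card; apply/fsubsetP => c.
  by rewrite in_fset /= inE => /andP[cc Pc]; rewrite inE (h c cc Pc).
exists a; split.
  split=> //; last by rewrite aE.
    rewrite /first_row_length sE; apply: (cle (fun c => c.1 == 0) (0, 0)).
    by move=> c; rewrite !inE => /orP[] /eqP ->.
  rewrite /first_col_length sE (@leq_trans #|` col|)//.
    by apply: fsubset_leq_card; apply/fsubsetP => c; rewrite !inE => /andP[].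
  by rewrite cardfs2.
move=> t; rewrite /beta; apply/eqP; rewrite eqn_leq; apply/andP; split.
  rewrite /descents sE; apply: (cle _ (1 - t, 0)) => c.
  by rewrite !inE => /orP[] /eqP ->; rewrite !aE; case: t => [[|[|?]] ?].
rewrite /descents sE cardfs_gt0; apply/fset0Pn; exists (1 - t, 0).
by rewrite !inE !aE; case: t => [[|[|?]] ?].
Qed.

(* Main.v *)
Require Import Defs.
From mathcomp Require Import all_boot all_fingroup.
From mathcomp Require Import finmap boolp classical_sets functions cardinality.
From mathcomp Require Import zify.

(* For a plane partition pi put G(i, r) = #{j | pi_(r,j) > i}.  The number of
   descents of i + 1 in row r is
     w(i, r) = G(i, r) - max (G(i + 1, r), G(i, r + 1)),
   which is the recurrence of last passage percolation.  So PP(k, n, m) is in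
   bijection with the m x n matrices w of last passage time G(0, 0) <= k, and
   the row sums of w are the descent numbers of pi.

   The crystal operator on rows i and i + 1 of w, with entries a and b, moves a
   unit from a_c to b_c, where c is the first maximizer of
     h r = a_0 + ... + a_r - (b_0 + ... + b_(r-1)).
   It preserves the last passage times outside row i + 1, and it is inverted by
   moving a unit back at the last maximizer.  It applies whenever max h > 0,
   hence whenever row i has the larger sum, and it lowers max h by one.  This
   gives D_alpha <= D_alpha' when alpha' moves a unit from a larger alpha_i to
   alpha_(i+1); iterating the operator |alpha_i - alpha_(i+1)| times gives the
   invariance under adjacent transpositions.  A sorted alpha is reached from
   any beta dominating it by such moves. *)

Set Implicit Arguments.
Unset Strict Implicit.
Unset Printing Implicit Defensive.

Local Open Scope nat_scope.

(** * Partial sums and last passage times *)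

Definition psum (a : nat -> nat) (r : nat) : nat := \sum_(u < r) a u.

Lemma psum0 a : psum a 0 = 0.
Proof. by rewrite /psum big_ord0. Qed.

Lemma psumS a r : psum a r.+1 = psum a r + a r.
Proof. by rewrite /psum big_ord_recr. Qed.

Lemma leq_psum a r s : r <= s -> psum a r <= psum a s.
Proof.
move=> /subnKC <-; elim: (s - r) => [|d IH]; rewrite ?addn0 ?addnS ?psumS//.
exact: leq_trans IH (leq_addr _ _).
Qed.

(* The last passage times of one row with weights [a], from column [r] on, when
   [X] are those of the row below; paths go to the last row and column. *)
Definition passage (n : nat) (a X : nat -> nat) (r : nat) : nat :=
  foldr (fun s y => a s + maxn (X s) y) 0 (iota r (n - r)).

Lemma passage_rec n a X r : r < n ->
  passage n a X r = a r + maxn (X r) (passage n a X r.+1).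
Proof. by rewrite /passage => rn; rewrite -(subnSK rn). Qed.

Lemma passage_out n a X r : n <= r -> passage n a X r = 0.
Proof. by rewrite /passage -subn_eq0 => /eqP ->. Qed.

Definition last_passage (n m : nat) (w : nat -> nat -> nat) (i : nat) : nat -> nat :=
  foldr (fun j X => passage n (w j) X) (fun=> 0) (iota i (m - i)).

Lemma last_passage_rec n m w i : i < m ->
  last_passage n m w i = passage n (w i) (last_passage n m w i.+1).
Proof. by rewrite /last_passage => im; rewrite -(subnSK im). Qed.

Lemma last_passage_out n m w i : m <= i -> last_passage n m w i = fun=> 0.
Proof. by rewrite /last_passage -subn_eq0 => /eqP ->. Qed.

Lemma last_passage_out_col n m w i r : n <= r -> last_passage n m w i r = 0.
Proof.
move=> nr; have [mi|im] := leqP m i; first by rewrite last_passage_out.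
by rewrite last_passage_rec// passage_out.
Qed.

Lemma last_passageE n m w i r : i < m -> r < n ->
  last_passage n m w i r =
  w i r + maxn (last_passage n m w i.+1 r) (last_passage n m w i r.+1).
Proof. by move=> im rn; rewrite last_passage_rec// passage_rec. Qed.

(** Downward induction on [i], then on [r]. This later identifies the row counts of a plane
    partition with last passage times. *)
Lemma last_passage_unique n m w (G : nat -> nat -> nat) :
  (forall i r, m <= i -> G i r = 0) -> (forall i r, n <= r -> G i r = 0) ->
  (forall i r, i < m -> r < n -> G i r = w i r + maxn (G i.+1 r) (G i r.+1)) ->
  forall i r, last_passage n m w i r = G i r.
Proof.
move=> Gm Gn GE i; move: {2}(m - i) (leqnn (m - i)) => d.
elim: d i => [|d IHd] i.
  by rewrite leqn0 subn_eq0 => mi r; rewrite last_passage_out ?Gm.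
move=> id r; have [mi|im] := leqP m i; first by rewrite last_passage_out ?Gm.
move: {2}(n - r) (leqnn (n - r)) => e; elim: e r => [|e IHe] r.
  by rewrite leqn0 subn_eq0 => nr; rewrite last_passage_out_col ?Gn.
move=> re; have [nr|rn] := leqP n r; first by rewrite last_passage_out_col ?Gn.
rewrite last_passageE// GE// IHd; last by lia.
by rewrite IHe//; lia.
Qed.

Lemma last_passage_row_le n m w i r : last_passage n m w i.+1 r <= last_passage n m w i r.
Proof.
have [mi|im] := leqP m i; first by rewrite !last_passage_out//; lia.
have [nr|rn] := leqP n r; first by rewrite !last_passage_out_col.
by rewrite (last_passageE _ im rn); lia.
Qed.

Lemma last_passage_col_le n m w i r : last_passage n m w i r.+1 <= last_passage n m w i r.
Proof.
have [mi|im] := leqP m i; first by rewrite !last_passage_out.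
have [nr|rn] := leqP n r; first by rewrite !last_passage_out_col//; lia.
by rewrite (last_passageE _ im rn); lia.
Qed.

(** A path from column [r] goes down at some [s], after collecting [a] on [[r, s]]. Thresholds avoid
    truncated subtraction, and the slack [y] lets two rows be chained. *)
Lemma passage_leP n a X r y Z : r < n ->
  passage n a X r + psum a r + y <= Z <->
  forall s, r <= s < n -> psum a s.+1 + X s + y <= Z.
Proof.
move: {2}(n - r) (leqnn (n - r)) => d; elim: d r => [|d IH] r dr rn; first by lia.
rewrite passage_rec//; have [rn'|nr] := ltnP r.+1 n; last first.
  rewrite passage_out//; split=> [h s sr|/(_ r)].
    have -> : s = r by lia.
    by rewrite psumS; lia.
  by rewrite psumS; lia.
have {}IH := IH r.+1 ltac:(lia) rn'; split=> [h s sr|h].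
  have [->|rs] := eqVneq s r; first by rewrite psumS; lia.
  by apply: (proj1 IH); rewrite ?psumS; lia.
have : passage n a X r.+1 + psum a r.+1 + y <= Z.
  by apply/IH => s sr; apply: h; lia.
by have := h r; rewrite !psumS; lia.
Qed.

Lemma passage2_leP n a b X r z : r < n ->
  passage n a (passage n b X) r <= z <->
  forall s t, r <= s -> s <= t < n ->
    psum b t.+1 + X t + psum a s.+1 <= z + psum a r + psum b s.
Proof.
move=> rn; split=> [h s t rs st|h].
  have {h} : passage n a (passage n b X) r + psum a r + 0 <= z + psum a r by lia.
  move/passage_leP => /(_ rn s ltac:(lia)) h.
  have {h} : passage n b X s + psum b s + psum a s.+1 <= z + psum a r + psum b s by lia.
  by move/passage_leP => /(_ ltac:(lia) t ltac:(lia)).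
suff : passage n a (passage n b X) r + psum a r + 0 <= z + psum a r by lia.
apply/passage_leP => // s /andP[rs sn].
suff : passage n b X s + psum b s + psum a s.+1 <= z + psum a r + psum b s by lia.
by apply/passage_leP => // t st; apply: h; lia.
Qed.

(** * Moving a unit between two adjacent rows *)

(* [c] is the first, resp. last, maximizer on [0, n) of
   [h r = psum a r.+1 - psum b r]; the boolean summand makes the inequality
   strict on one side of [c]. *)
Definition first_max n (a b : nat -> nat) c := c < n /\
  forall r, r < n -> psum a r.+1 + psum b c + (r < c) <= psum a c.+1 + psum b r.

Definition last_max n (a b : nat -> nat) c := c < n /\
  forall r, r < n -> psum a r.+1 + psum b c + (c < r) <= psum a c.+1 + psum b r.

Lemma first_max_exists n a b : 0 < n -> exists c, first_max n a b c.
Proof.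
elim: n => // -[_ _|n IH _].
  by exists 0; split=> // -[]//; lia.
have [//|c [cn hc]] := IH.
have [h|h] := ltnP (psum a c.+1 + psum b n.+1) (psum a n.+2 + psum b c).
  exists n.+1; split=> // r; rewrite ltnS leq_eqVlt => /orP[/eqP ->|rn]; first by lia.
  by have := hc r rn; lia.
exists c; split=> [|r]; first by lia.
rewrite ltnS leq_eqVlt => /orP[/eqP ->|rn]; first by lia.
by have := hc r rn; lia.
Qed.

Lemma last_max_exists n a b : 0 < n -> exists c, last_max n a b c.
Proof.
elim: n => // -[_ _|n IH _].
  by exists 0; split=> // -[]//; lia.
have [//|c [cn hc]] := IH.
have [h|h] := leqP (psum a c.+1 + psum b n.+1) (psum a n.+2 + psum b c).
  exists n.+1; split=> // r; rewrite ltnS leq_eqVlt => /orP[/eqP ->|rn]; first by lia.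
  by have := hc r rn; lia.
exists c; split=> [|r]; first by lia.
rewrite ltnS leq_eqVlt => /orP[/eqP ->|rn]; first by lia.
by have := hc r rn; lia.
Qed.

Lemma first_max_unique n a b c d : first_max n a b c -> first_max n a b d -> c = d.
Proof. by move=> [cn hc] [dn hd]; have := hc d dn; have := hd c cn; lia. Qed.

Lemma last_max_unique n a b c d : last_max n a b c -> last_max n a b d -> c = d.
Proof. by move=> [cn hc] [dn hd]; have := hc d dn; have := hd c cn; lia. Qed.

Lemma psum_add_unit a a' c : (forall u, a' u + (u == c) = a u) ->
  forall r, psum a' r + (c < r) = psum a r.
Proof.
move=> h; elim=> [|r IH]; first by rewrite !psum0.
by rewrite !psumS -h -IH ltnS [c <= r]leq_eqVlt; lia.
Qed.

Section TwoRows.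
Variables (n c : nat) (a b a' b' : nat -> nat).
Hypothesis aE : forall u, a' u + (u == c) = a u.
Hypothesis bE : forall u, b u + (u == c) = b' u.

(** The move keeps [h r] for [r < c], lowers it by 1 at [c] and by 2 for [r > c], so strictness
    passes from the left of [c] to its right. *)
Lemma first_max_last_max : first_max n a b c <-> last_max n a' b' c.
Proof.
have A := psum_add_unit aE; have B := psum_add_unit bE.
have Ac := A c.+1; have Bc := B c.
by split=> -[cn h]; split=> // r rn;
  have := h r rn; have := A r.+1; have := B r; lia.
Qed.

(* For [r <= c <= t], the maximum over [s] of [h s] decreases by one, which the
   additional unit of [b] compensates; all other cases are neutral. *)
Lemma passage2_move X r : first_max n a b c ->
  passage n a (passage n b X) r = passage n a' (passage n b' X) r.
Proof.
move=> [cn h]; have [nr|rn] := leqP n r; first by rewrite !passage_out.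
have A := psum_add_unit aE; have B := psum_add_unit bE.
suff H z : passage n a (passage n b X) r <= z <->
           passage n a' (passage n b' X) r <= z.
  by apply/eqP; rewrite eqn_leq; apply/andP; split; apply/H.
(* The path that turns down at [s] and leaves at [t] is bounded by the one with the same turns or,
   if [r <= c <= t], by the one turning at [c]. *)
rewrite !passage2_leP//; split=> H s t rs st.
  have Hs := H s t rs st; have Hc := H c t; have := h s.
  have := A r; have := B s; have := A s.+1; have := B t.+1; have := A c.+1.
  have := B c; lia.
have Hs := H s t rs st; have Hc := H c t; have := h s.
have := A r; have := B s; have := A s.+1; have := B t.+1; have := A c.+1.
have := B c; lia.
Qed.

End TwoRows.

(** * Comparing cardinalities through relations *)

(** Choice extracts an injection from [R], so the partial operator [crystal] can stay a relation. *)
Lemma card_le_rel (T U : Type) (A : set T) (B : set U) (R : T -> U -> Prop) :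
  (forall x, A x -> exists2 y, B y & R x y) ->
  (forall x x' y, R x y -> R x' y -> x = x') -> (A #<= B)%card.
Proof.
move=> tot inj; have [->|/set0P[x0 /tot[y0 _ _]]] := eqVneq A set0.
  exact: card_ge0.
have [f fP] : {f : T -> U & forall x, A x -> B (f x) /\ R x (f x)}.
  apply: (@choice _ _ (fun x y => A x -> B y /\ R x y)) => x.
  by have [/tot[y By Rxy]|] := pselect (A x); [exists y|exists y0].
apply/card_subP; exists (f @` A)%classic.
  apply: inj_card_eq => x y; rewrite !inE => Ax Ay fxy.
  by apply: inj (proj2 (fP x Ax)) _; rewrite fxy; exact: (proj2 (fP y Ay)).
by move=> _ [x Ax <-]; exact: (proj1 (fP x Ax)).
Qed.

Lemma leq_card_fset_set_le (T U : choiceType) (A : set T) (B : set U) :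
  finite_set A -> finite_set B -> (A #<= B)%card ->
  #|` fset_set A| <= #|` fset_set B|.
Proof.
move=> /finite_setP[a Aa] /finite_setP[b Bb].
rewrite (card_fset_set Aa) (card_fset_set Bb).
by rewrite (card_le_eql Aa) (card_le_eqr Bb) card_le_II.
Qed.

Definition unit_moved i c (w w' : nat -> nat -> nat) := forall j u,
  w' j u + ((j == i) && (u == c)) = w j u + ((j == i.+1) && (u == c)).

Definition crystal n i (w w' : nat -> nat -> nat) := exists2 c,
  first_max n (w i) (w i.+1) c & unit_moved i c w w'.

Lemma unit_moved_top i c w w' : unit_moved i c w w' ->
  forall u, w' i u + (u == c) = w i u.
Proof. by move=> h u; have := h i u; rewrite eqxx (_ : (i == i.+1) = false); lia. Qed.

Lemma unit_moved_bot i c w w' : unit_moved i c w w' ->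
  forall u, w i.+1 u + (u == c) = w' i.+1 u.
Proof. by move=> h u; have := h i.+1 u; rewrite eqxx (_ : (i.+1 == i) = false); lia. Qed.

Lemma unit_moved_other i c w w' : unit_moved i c w w' ->
  forall j, j <> i -> j <> i.+1 -> w j = w' j.
Proof. by move=> h j ji ji1; apply: funext => u; have := h j u; lia. Qed.

(** The column of the move is recovered from [w'] as its last maximizer. *)
Lemma crystal_inj n i w1 w2 w' : crystal n i w1 w' -> crystal n i w2 w' -> w1 = w2.
Proof.
move=> [c1 h1 m1] [c2 h2 m2].
have l1 := proj1 (first_max_last_max n (unit_moved_top m1) (unit_moved_bot m1)) h1.
have l2 := proj1 (first_max_last_max n (unit_moved_top m2) (unit_moved_bot m2)) h2.
have ec := last_max_unique l1 l2; rewrite -{}ec in m2.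
by apply: funext => j; apply: funext => u; have := m1 j u; have := m2 j u; lia.
Qed.

Lemma crystal_fun n i w w1 w2 : crystal n i w w1 -> crystal n i w w2 -> w1 = w2.
Proof.
move=> [c1 h1 m1] [c2 h2 m2].
have ec := first_max_unique h1 h2; rewrite -{}ec in m2.
by apply: funext => j; apply: funext => u; have := m1 j u; have := m2 j u; lia.
Qed.

(** Rows below [i.+1] have unchanged weights, row [i] is [passage2_move], and the rows above follow
    by recursion. *)
Lemma last_passage_crystal n m i w w' j : i.+1 < m -> crystal n i w w' ->
  j <> i.+1 -> last_passage n m w j = last_passage n m w' j.
Proof.
move=> im [c hc mv].
have low l : i.+1 < l -> last_passage n m w l = last_passage n m w' l.
  move=> il; rewrite /last_passage.
  have : all (fun j => i.+1 < j) (iota l (m - l)).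
    by apply/allP => q; rewrite mem_iota; lia.
  elim: (iota _ _) => //= q s IH /andP[iq /IH ->].
  by rewrite (unit_moved_other mv) //; lia.
have at_i : last_passage n m w i = last_passage n m w' i.
  apply: funext => r; rewrite !(@last_passage_rec n m _ i) ?(ltnW im)//.
  rewrite !(@last_passage_rec n m _ i.+1)// low//.
  exact: (passage2_move (unit_moved_top mv) (unit_moved_bot mv)).
move=> ji; have [ij|ij] := ltnP i.+1 j; first exact: low.
have {ij ji} : j <= i by lia.
move=> /subnKC; move: (i - j) => d; elim: d j => [|d IH] j jd.
  by rewrite (_ : j = i)//; lia.
rewrite !(@last_passage_rec n m _ j); try lia.
by rewrite IH ?(unit_moved_other mv)//; lia.
Qed.

Definition passage_matrices k n m (alpha : 'I_m -> nat) : set (nat -> nat -> nat) :=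
  [set w | [/\ forall i r, m <= i -> w i r = 0, forall i r, n <= r -> w i r = 0,
     last_passage n m w 0 0 <= k & forall t : 'I_m, psum (w t) n = alpha t]]%classic.

(* [depth_ge n i p w]: the maximum of [psum (w i) r.+1 - psum (w i.+1) r] is at
   least [p]; it is the number of times that [crystal n i] applies to [w]. *)
Definition depth_ge n i p (w : nat -> nat -> nat) :=
  exists2 c, c < n & psum (w i.+1) c + p <= psum (w i) c.+1.

(** The column [c] attains the maximum of [h] before and after the move, and [h c] drops by one. *)
Lemma crystal_depth_ge n i p w w' : crystal n i w w' ->
  depth_ge n i p.+1 w <-> depth_ge n i p w'.
Proof.
move=> [c hc mv]; have A := psum_add_unit (unit_moved_top mv).
have B := psum_add_unit (unit_moved_bot mv).
have [cn hl] := proj1 (first_max_last_max n (unit_moved_top mv) (unit_moved_bot mv)) hc.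
have {hc} [_ hc] := hc.
have := A c.+1; have := B c.
by split=> -[d dn hd]; exists c => //; have := hc d dn; have := hl d dn; lia.
Qed.

Section Step.
Variables (k n m : nat) (n_gt0 : 0 < n) (i j : 'I_m) (ij : j = i.+1 :> nat).

(** The bound at [(0, 0)] survives because row 0 is never row [i.+1]. *)
Lemma crystal_matrices (alpha alpha' : 'I_m -> nat) w w' :
  (forall t, alpha' t + (t == i) = alpha t + (t == j)) -> crystal n i w w' ->
  passage_matrices k n alpha w <-> passage_matrices k n alpha' w'.
Proof.
move=> E cr; have im : i.+1 < m by rewrite -ij.
have lp := last_passage_crystal im cr; case: cr => c [cn hc] mv.
have rows (t : 'I_m) : psum (w' t) n + (t == i) = psum (w t) n + (t == j).
  have [->|ti] := eqVneq t i.
    have := psum_add_unit (unit_moved_top mv) n.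
    have -> : (i == j) = false by apply/eqP => e; move: ij; rewrite e; lia.
    by rewrite cn; lia.
  have [->|tj] := eqVneq t j.
    by have := psum_add_unit (unit_moved_bot mv) n; rewrite cn ij; lia.
  by rewrite (unit_moved_other mv)// => e; [move: ti|move: tj];
    rewrite -val_eqE/= e ?ij eqxx.
split=> -[wm wn wk wa]; split=> //.
- move=> i' r mi'; have := wm i' r mi'; have := mv i' r.
  have [-> -> ] : i' == i = false /\ i' == i.+1 = false by lia.
  lia.
- move=> i' r nr; have := wn i' r nr; have := mv i' r.
  have -> : r == c = false by lia.
  by rewrite !andbF; lia.
- by rewrite -lp.
- by move=> t; have := rows t; have := E t; have := wa t; lia.
- move=> i' r mi'; have := wm i' r mi'; have := mv i' r.
  have [-> -> ] : i' == i = false /\ i' == i.+1 = false by lia.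
  lia.
- move=> i' r nr; have := wn i' r nr; have := mv i' r.
  have -> : r == c = false by lia.
  by rewrite !andbF; lia.
- by rewrite lp.
- by move=> t; have := rows t; have := E t; have := wa t; lia.
Qed.

Lemma crystal_exists w : depth_ge n i 1 w -> exists w', crystal n i w w'.
Proof.
move=> [d dn hd]; have [c hc] := first_max_exists (w i) (w i.+1) n_gt0.
(* If [c = 0], then [w i 0 = h 0 >= h d > 0]; otherwise [h (c - 1) < h c] means
   [w i.+1 (c - 1) < w i c]. *)
have wc : 0 < w i c.
  case: hc => cn hc; have := hc d dn.
  case: c cn hc => [|c] cn hc; first by have := psumS (w i) 0; rewrite !psum0; lia.
  by have := hc c (ltnW cn); rewrite !psumS; lia.
pose w' q u := w q u + ((q == i.+1) && (u == c)) - ((q == i :> nat) && (u == c)).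
exists w', c => // q u; rewrite /w'.
have [/andP[/eqP -> /eqP ->]|_] := boolP ((q == i :> nat) && (u == c)); lia.
Qed.

Lemma crystal_exists_inv w p : depth_ge n i p w ->
  psum (w i) n < psum (w i.+1) n + p -> exists w', crystal n i w' w.
Proof.
move=> [d dn hd] wp; have [c hc] := last_max_exists (w i) (w i.+1) n_gt0.
(* If [c + 1 < n], then [h (c + 1) < h c] gives [w i (c + 1) < w i.+1 c]. If [c = n - 1], then
   [h c >= p] exceeds the difference of the full row sums, so [w i.+1 c > 0]. *)
have wc : 0 < w i.+1 c.
  case: hc => cn hc; have := hc d dn; have [cn'|nc] := ltnP c.+1 n.
    by have := hc c.+1 cn'; have := psumS (w i) c.+1; have := psumS (w i.+1) c; lia.
  have nE : n = c.+1 by lia.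
  by rewrite nE in wp; have := psumS (w i.+1) c; lia.
pose w' q u := w q u + ((q == i :> nat) && (u == c)) - ((q == i.+1) && (u == c)).
have mv : unit_moved i c w' w.
  move=> q u; rewrite /w'.
  have [/andP[/eqP -> /eqP ->]|_] := boolP ((q == i.+1) && (u == c)); lia.
exists w', c => //.
by apply/(first_max_last_max n (unit_moved_top mv) (unit_moved_bot mv)).
Qed.

Lemma matrices_transfer_le (alpha alpha' : 'I_m -> nat) :
  (forall t, alpha' t + (t == i) = alpha t + (t == j)) -> alpha j < alpha i ->
  (passage_matrices k n alpha #<= passage_matrices k n alpha')%card.
Proof.
move=> E ji; apply: (card_le_rel (R := crystal n i)); last exact: crystal_inj.
move=> w Aw; have [_ _ _ wa] := Aw.
have [|w' cr] := @crystal_exists w.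
  (* At the last column, [h] is at least [alpha i - alpha j > 0]. *)
  exists n.-1; first by lia.
  rewrite prednK// (wa i) (leq_trans _ ji)// -(wa j) ij addn1 ltnS.
  by apply: leq_psum; lia.
by exists w' => //; apply/(crystal_matrices E cr).
Qed.

Let deep (alpha : 'I_m -> nat) p :=
  (passage_matrices k n alpha `&` depth_ge n i p)%classic.

(** The bound on [alpha' i] is what [crystal_exists_inv] needs, so the operator is onto the matrices
    of depth at least [p]. *)
Lemma card_deep (alpha alpha' : 'I_m -> nat) p :
  (forall t, alpha' t + (t == i) = alpha t + (t == j)) ->
  alpha' i < alpha' j + p ->
  (deep alpha p.+1 #= deep alpha' p)%card.
Proof.
move=> E lt_p; rewrite card_eq_le; apply/andP; split.
  apply: (card_le_rel (R := crystal n i)); last exact: crystal_inj.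
  move=> w [Aw dw]; have [|w' cr] := @crystal_exists w.
    by case: dw => c cn cp; exists c => //; lia.
  exists w' => //; split; first exact/(crystal_matrices E cr).
  exact/(crystal_depth_ge _ cr).
apply: (card_le_rel (R := fun w w' => crystal n i w' w)); last first.
  by move=> ? ? ?; exact: crystal_fun.
move=> w [Aw dw]; have [_ _ _ wa] := Aw.
have [|w' cr] := crystal_exists_inv dw.
  by rewrite -ij !wa.
exists w' => //; split; first exact/(crystal_matrices E cr).
exact/(crystal_depth_ge _ cr).
Qed.

Lemma matrices_adjacent_swap (alpha : 'I_m -> nat) :
  (passage_matrices k n alpha #= passage_matrices k n (alpha \o tperm i j))%card.
Proof.
have nij : i != j by rewrite -val_eqE/= ij; lia.
wlog le_ij : alpha / alpha i <= alpha j => [hw|].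
  have [/hw//|ji] := leqP (alpha i) (alpha j).
  rewrite card_eq_sym; have := hw (alpha \o tperm i j).
  rewrite /= tpermL tpermR => /(_ (ltnW ji)); congr (_ #= _)%card.
  by congr passage_matrices; apply: funext => t /=; rewrite tpermK.
(* [A p] runs from [alpha] at [p = 0] to the swapped vector at [p = d]. All sets [deep (A p) p] are
   equinumerous, and at both ends the depth condition holds automatically. *)
pose A p t := if t == i then alpha i + p else if t == j then alpha j - p else alpha t.
pose d := alpha j - alpha i.
have step p : p <= d -> (deep (A p) p #= deep (A 0) 0)%card.
  elim: p => [|p IH] pd; first exact: card_eqxx.
  apply: card_eq_trans (IH (ltnW pd)); apply: card_deep.
    move=> t; rewrite /A; have [->|ti] := eqVneq t i.
      by rewrite (negPf nij); lia.
    by have [_|_] := eqVneq t j; lia.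
  by rewrite /A eqxx eq_sym (negPf nij) eqxx; rewrite /d in pd; lia.
have full (be : 'I_m -> nat) p : p <= be i - be j -> deep be p = passage_matrices k n be.
  move=> hp; apply/seteqP; split=> [w []//|w Aw]; split=> //.
  have [pz|p_gt0] := posnP p; first by exists 0; rewrite ?pz ?psum0.
  have [_ _ _ wa] := Aw; exists n.-1; first by lia.
  rewrite prednK// wa; have := wa j; rewrite ij.
  by have := @leq_psum (w i.+1) n.-1 n (leq_pred n); lia.
have A0 : A 0 = alpha.
  apply: funext => t; rewrite /A; have [->|ti] := eqVneq t i; first by lia.
  by have [->|tj] := eqVneq t j; lia.
have Ad : A d = alpha \o tperm i j.
  apply: funext => t; rewrite /A /d /=; have [->|ti] := eqVneq t i.
    by rewrite tpermL; lia.
  have [->|tj] := eqVneq t j; first by rewrite tpermR; lia.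
  by rewrite tpermD// eq_sym.
have := step d (leqnn d); rewrite card_eq_sym A0 Ad !full//=.
by rewrite tpermL tpermR.
Qed.

End Step.

(** * The bijection between plane partitions and matrices *)

(** A downward closed predicate holds on an initial segment. This is conjugation of partitions, used
    both from entries to row counts and back. *)
Lemma ltn_count_iota (p : pred nat) k j : (forall i l, i <= l -> p l -> p i) ->
  (j < count p (iota 0 k)) = (j < k) && p j.
Proof.
move=> dp; elim: k => // k IH; rewrite -(addn1 k) iotaD count_cat /= add0n addn0.
have cle : count p (iota 0 k) <= k by rewrite -{2}(size_iota 0 k) count_size.
have [pk|npk] := boolP (p k).
  have -> : count p (iota 0 k) = k.
    rewrite -[RHS](size_iota 0); apply/eqP; rewrite -all_count; apply/allP => i.
    by rewrite mem_iota => ik; apply: dp pk; lia.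
  by have [jk|//] := ltnP j (k + 1); rewrite (dp j k)//; lia.
rewrite addn0 IH; have [jk|jk] := ltnP j k; first by rewrite (ltn_addr _ jk).
have [|//] := ltnP j (k + 1) => jk'.
have -> : j = k by lia.
by rewrite (negPf npk).
Qed.

Lemma count_iota_itv x y k : y <= k ->
  count (fun j => x <= j < y) (iota 0 k) = y - x.
Proof.
move=> yk; suff -> : count (fun j => x <= j < y) (iota 0 k) = minn y k - x by lia.
elim: k {yk} => [|k IH]; first by rewrite minn0.
by rewrite -(addn1 k) iotaD count_cat /= IH; lia.
Qed.

Definition row_count k (a : array) i r := count (fun j => i < a (r, j)) (iota 0 k).

Definition descent_matrix k n m (a : array) i r :=
  if (i < m) && (r < n)
  then row_count k a i r - maxn (row_count k a i.+1 r) (row_count k a i r.+1) else 0.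

Definition box k n : {fset nat * nat} :=
  [fset c in [seq (r, j) | r <- iota 0 n, j <- iota 0 k]]%fset.

Lemma in_box k n r j : ((r, j) \in box k n) = (r < n) && (j < k).
Proof.
rewrite !inE; apply/allpairsP/idP => [[[u v] /= []]|/andP[rn jk]].
  by rewrite !mem_iota => ? ? [-> ->]; lia.
by exists (r, j); rewrite !mem_iota.
Qed.

Lemma PP_out k n m (a : array) r j : PP k n m a -> ~~ ((r < n) && (j < k)) ->
  a (r, j) = 0.
Proof. by move=> Pa; apply: contraNeq => /(PP_box Pa)[-> ->]. Qed.

Section DescentMatrix.
Variables (k n m : nat) (a : array) (Pa : PP k n m a).

Let pa : plane_partition a. Proof. by case: Pa. Qed.

Let entry_le r j : a (r, j) <= m.
Proof. by case: Pa => _ _ _; apply: leq_trans; exact: plane_partition_le. Qed.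

Lemma ltn_row_count i r j : (j < row_count k a i r) = (i < a (r, j)).
Proof.
rewrite ltn_count_iota; last first.
  move=> u v uv /leq_trans; apply; exact: plane_partition_le.
have [//|kj] := ltnP j k; rewrite (PP_out Pa)//.
by rewrite negb_and -!leqNgt kj orbT.
Qed.

Lemma row_count_le i r : row_count k a i r <= k.
Proof. by rewrite -{2}(size_iota 0 k) count_size. Qed.

Lemma row_count_decr i r :
  row_count k a i.+1 r <= row_count k a i r /\ row_count k a i r.+1 <= row_count k a i r.
Proof.
split; apply: sub_count => j /=; first exact: ltnW.
by move=> /leq_trans; apply; exact: (proj1 (pa r j)).
Qed.

(** [descent_matrix] solves the passage recurrence for the weights; its subtraction is exact by
    [row_count_decr]. *)
Lemma last_passage_descent_matrix i r :
  last_passage n m (descent_matrix k n m a) i r = row_count k a i r.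
Proof.
apply: last_passage_unique => {}i {}r.
- move=> mi; apply/eqP; rewrite -leqn0 leqNgt -has_count; apply/hasPn => j _.
  by rewrite -leqNgt (leq_trans (entry_le r j) mi).
- move=> nr; apply/eqP; rewrite -leqn0 leqNgt -has_count; apply/hasPn => j _.
  by rewrite (PP_out Pa)// ltnNge nr.
- by move=> im rn; rewrite /descent_matrix im rn /=; have := row_count_decr i r; lia.
Qed.

(** The descents of [i.+1] in row [r] fill the interval of columns from
    [maxn (G(i + 1, r)) (G(i, r + 1))] up to, but excluding, [G(i, r)]. *)
Lemma descents_psum i : i < m -> descents a i.+1 = psum (descent_matrix k n m a i) n.
Proof.
move=> im; pose P r j := (a (r, j) == i.+1) && (a (r.+1, j) < i.+1).
pose s := [seq (r, j) | r <- iota 0 n, j <- filter (P r) (iota 0 k)].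
have us : uniq s.
  apply: allpairs_uniq_dep; first exact: iota_uniq.
    by move=> r _; rewrite filter_uniq// iota_uniq.
  by move=> [? ?] [? ?] _ _ [-> ->].
have -> : descents a i.+1 = size s.
  apply: perm_size; apply: uniq_perm => // -[r j]; rewrite !inE /=.
  rewrite -/(P r j); apply/andP/allpairsPdep => /= [[arj Prj]|].
    rewrite mem_finsupp in arj; have [rn jk _] := PP_box Pa arj.
    by exists r, j; rewrite mem_filter Prj !mem_iota.
  move=> [u [v [_ + [-> ->]]]]; rewrite mem_filter => /andP[Puv _]; split=> //.
  by case/andP: Puv => /eqP au _; rewrite mem_finsupp au.
rewrite size_allpairs_dep sumnE big_map /psum.
rewrite -{1}[n]subn0 -/(index_iota 0 n) big_mkord; apply: eq_bigr => -[r rn] _ /=.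
rewrite size_filter /descent_matrix im rn /= -(@count_iota_itv _ _ k); last first.
  exact: row_count_le.
apply: eq_count => j; rewrite /P geq_max !ltn_row_count.
have := proj1 (pa r j); rewrite ![row_count _ _ _ _ <= _]leqNgt !ltn_row_count.
by move: (a (r, j)) (a (r.+1, j)) => x y; lia.
Qed.

End DescentMatrix.

Definition array_of_matrix k n m (w : nat -> nat -> nat) : array :=
  [fsfun c in box k n =>
     count (fun i => c.2 < last_passage n m w i c.1) (iota 0 m) | 0]%fset.

Lemma last_passage_decr n m w i i' r r' : i <= i' -> r <= r' ->
  last_passage n m w i' r' <= last_passage n m w i r.
Proof.
move=> /subnKC <- /subnKC <-; elim: (i' - i) => [|d IH]; last first.
  by rewrite addnS (leq_trans (last_passage_row_le _ _ _ _ _)).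
rewrite addn0; elim: (r' - r) => [|d IH]; rewrite ?addn0// addnS.
by rewrite (leq_trans (last_passage_col_le _ _ _ _ _)).
Qed.

Section ArrayOfMatrix.
Variables (k n m : nat) (w : nat -> nat -> nat) (wk : last_passage n m w 0 0 <= k).

Lemma array_of_matrixE r j :
  array_of_matrix k n m w (r, j) = count (fun i => j < last_passage n m w i r) (iota 0 m).
Proof.
rewrite fsfun_fun in_box /=; case: ifP => // nb; apply/esym/eqP.
(* The default 0 is right outside the box: passage times vanish for [n <= r] and are otherwise at
   most [k <= j]. *)
rewrite -leqn0 leqNgt -has_count; apply/hasPn => i _; rewrite -leqNgt.
have [nr|rn] := leqP n r; first by rewrite last_passage_out_col.
have := @last_passage_decr n m w 0 i 0 r (leq0n _) (leq0n _); lia.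
Qed.

Lemma ltn_array_of_matrix i r j :
  (i < array_of_matrix k n m w (r, j)) = (j < last_passage n m w i r).
Proof.
rewrite array_of_matrixE ltn_count_iota; last first.
  by move=> u v uv /leq_trans; apply; exact: last_passage_decr.
by have [//|mi] := ltnP i m; rewrite last_passage_out.
Qed.

Lemma array_of_matrix_PP : PP k n m (array_of_matrix k n m w).
Proof.
have supp r j : (r, j) \in finsupp (array_of_matrix k n m w) -> (r < n) && (j < k).
  by rewrite mem_finsupp fsfun_fun in_box /=; case: ifP; rewrite ?eqxx.
split.
- move=> r j; rewrite !array_of_matrixE; split; apply: sub_count => i /=.
    by move=> /leq_trans; apply; exact: last_passage_col_le.
  exact: ltnW.
- apply: (@leq_trans (size [seq (0, j) | j <- iota 0 k])); last first.
    by rewrite size_map size_iota.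
  apply: uniq_leq_size; first exact: fset_uniq.
  move=> [r j]; rewrite !inE /= => /andP[/supp/andP[_ jk] /eqP ->].
  by apply: map_f; rewrite mem_iota.
- apply: (@leq_trans (size [seq (r, 0) | r <- iota 0 n])); last first.
    by rewrite size_map size_iota.
  apply: uniq_leq_size; first exact: fset_uniq.
  move=> [r j]; rewrite !inE /= => /andP[/supp/andP[rn _] /eqP ->].
  by apply: (map_f (fun r => (r, 0))); rewrite mem_iota.
- by rewrite array_of_matrixE -[leqRHS](size_iota 0 m) count_size.
Qed.

Lemma row_count_array_of_matrix i r :
  row_count k (array_of_matrix k n m w) i r = last_passage n m w i r.
Proof.
rewrite -[RHS]subn0 -(@count_iota_itv _ _ k).
  by apply: eq_count => j; rewrite ltn_array_of_matrix.
exact: leq_trans (last_passage_decr _ _ _ (leq0n i) (leq0n r)) wk.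
Qed.

Lemma descent_matrixK :
  (forall i r, m <= i -> w i r = 0) -> (forall i r, n <= r -> w i r = 0) ->
  descent_matrix k n m (array_of_matrix k n m w) = w.
Proof.
move=> wm wn; apply: funext => i; apply: funext => r; rewrite /descent_matrix.
have [im|mi] := ltnP i m; last by rewrite wm.
have [rn|nr] := ltnP r n; last by rewrite wn.
by rewrite /= !row_count_array_of_matrix last_passageE//; lia.
Qed.

End ArrayOfMatrix.

Lemma array_of_matrixK k n m (a : array) : PP k n m a ->
  array_of_matrix k n m (descent_matrix k n m a) = a.
Proof.
move=> Pa; have lp := last_passage_descent_matrix Pa.
apply/fsfunP => -[r j]; rewrite array_of_matrixE; last first.
  by rewrite lp row_count_le.
have am : a (r, j) <= m.
  by case: Pa => pa _ _; apply: leq_trans; exact: plane_partition_le.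
rewrite -[RHS]subn0 -(count_iota_itv 0 am).
by apply: eq_count => i; rewrite lp (ltn_row_count Pa).
Qed.

Lemma card_PP_descents k n m (alpha : 'I_m -> nat) :
  (PP_descents k n alpha #= passage_matrices k n alpha)%card.
Proof.
rewrite card_eq_le; apply/andP; split.
  apply: (card_le_rel (R := fun a w => PP k n m a /\ w = descent_matrix k n m a)).
    move=> a [Pa da]; exists (descent_matrix k n m a) => //; split.
    - by move=> i r mi; rewrite /descent_matrix ltnNge mi.
    - by move=> i r nr; rewrite /descent_matrix [r < n]ltnNge nr andbF.
    - by rewrite (last_passage_descent_matrix Pa) row_count_le.
    - by move=> t; rewrite -(descents_psum Pa)// da.
  move=> a a' w [Pa ->] [Pa' e].
  by rewrite -(array_of_matrixK Pa) e array_of_matrixK.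
apply: (card_le_rel (R := fun w a => passage_matrices k n alpha w /\
                                     a = array_of_matrix k n m w)).
  move=> w Aw; have [wm wn wk wa] := Aw; have Pw := array_of_matrix_PP wk.
  exists (array_of_matrix k n m w) => //; split=> // t.
  by rewrite (descents_psum Pw)// descent_matrixK.
move=> w w' a [[wm wn wk _] ->] [[wm' wn' wk' _] e].
by rewrite -(descent_matrixK wk wm wn) e descent_matrixK.
Qed.

(** * Symmetry *)

Lemma D_le_card k n m (alpha beta : 'I_m -> nat) :
  (passage_matrices k n alpha #<= passage_matrices k n beta)%card ->
  D k n alpha <= D k n beta.
Proof.
move=> AB; apply: leq_card_fset_set_le; try exact: finite_PP_descents.
rewrite (card_le_eql (card_PP_descents _ _ _)).
by rewrite (card_le_eqr (card_PP_descents _ _ _)).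
Qed.

Lemma D_adjacent_swap k n m (i j : 'I_m) (alpha : 'I_m -> nat) : 0 < n ->
  j = i.+1 :> nat -> D k n (alpha \o tperm i j) = D k n alpha.
Proof.
move=> n_gt0 ij; have /card_eqPle[le1 le2] := matrices_adjacent_swap k n_gt0 ij alpha.
by apply/eqP; rewrite eqn_leq !D_le_card.
Qed.

Lemma D_tperm k n m (i j : 'I_m) (alpha : 'I_m -> nat) : 0 < n ->
  D k n (alpha \o tperm i j) = D k n alpha.
Proof.
move=> n_gt0; wlog ij : i j / i <= j => [hw|].
  by have [/hw//|/ltnW/hw] := leqP i j; rewrite tpermC.
have [d dE] : exists d, d = j - i by exists (j - i).
elim: d j ij dE alpha => [|d IH] j ij dE alpha.
  have -> : j = i by apply/val_inj => /=; lia.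
  by rewrite tperm1; congr (D k n _); apply: funext => t /=; rewrite perm1.
have pm : j.-1 < m by have := ltn_ord j; lia.
pose l := Ordinal pm; have lj : j = l.+1 :> nat by rewrite /= prednK//; lia.
have [il|il] := eqVneq i l; first by rewrite il (D_adjacent_swap _ _ n_gt0).
(* With [l = j - 1], conjugating [(i l)] by the adjacent transposition [(l j)] yields [(i j)]. *)
have -> : tperm i j = (tperm l j * tperm i l * tperm l j)%g.
  rewrite -{1}[tperm l j]tpermV -mulgA -conjgE tpermJ tpermL tpermD// 1?eq_sym.
    by [].
  by rewrite -val_eqE /=; lia.
transitivity (D k n (((alpha \o tperm l j) \o tperm i l) \o tperm l j)).
  by congr (D k n _); apply: funext => t /=; rewrite !permM.
by rewrite (D_adjacent_swap _ _ n_gt0)// IH ?(D_adjacent_swap _ _ n_gt0)//=; lia.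
Qed.

Lemma D_perm k n m (s : 'S_m) (alpha : 'I_m -> nat) : 0 < n ->
  D k n (alpha \o s) = D k n alpha.
Proof.
move=> n_gt0; have [ts -> _] := prod_tpermP s.
elim: ts alpha => [|[i j] ts IH] alpha.
  by rewrite big_nil; congr (D k n _); apply: funext => t /=; rewrite perm1.
rewrite big_cons /=.
transitivity (D k n ((alpha \o (\prod_(x <- ts) tperm x.1 x.2)%g) \o tperm i j)).
  by congr (D k n _); apply: funext => t /=; rewrite permM.
by rewrite D_tperm// IH.
Qed.

(** * Monotonicity in the dominance order *)

Section PartialSums.
Variable m : nat.
Implicit Types (alpha : 'I_m -> nat) (i : 'I_m) (l : nat).

Definition partial alpha l := \sum_(t < m | t < l) alpha t.

Lemma partial0 alpha : partial alpha 0 = 0.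
Proof. by rewrite /partial big_pred0. Qed.

Lemma partialS alpha i : partial alpha i.+1 = partial alpha i + alpha i.
Proof.
rewrite /partial (bigD1 i)//= addnC; congr (_ + _); apply: eq_bigl => t.
by rewrite -val_eqE /=; lia.
Qed.

Lemma partial_weight alpha : partial alpha m = weight alpha.
Proof. by apply: eq_bigl => t; rewrite ltn_ord. Qed.

Lemma partial_unit i l : partial (fun t => t == i) l = (i < l).
Proof.
rewrite /partial; have [il|li] := ltnP i l.
  by rewrite (bigD1 i)//= eqxx big1// => t /andP[_ /negPf ->].
by rewrite big1// => t tl; case: eqP => // ti; move: tl; rewrite ti; lia.
Qed.

Lemma partialD alpha beta l :
  partial (fun t => alpha t + beta t) l = partial alpha l + partial beta l.
Proof. exact: big_split. Qed.

End PartialSums.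

Lemma D_dominance k n m (alpha beta : 'I_m -> nat) : 0 < n -> nonincreasing alpha ->
  dominates beta alpha -> weight alpha = weight beta -> D k n beta <= D k n alpha.
Proof.
move=> n_gt0 anoninc.
(* Induction on the total of the partial sums of [beta], which every move lowers by one. *)
have [N] : exists N, \sum_(l < m.+1) partial beta l < N by eexists; exact: ltnSn.
elim: N beta => // N IH beta; rewrite ltnS => leN dom wE.
have {}dom l : l <= m -> partial alpha l <= partial beta l.
  by case: l => [|l] lm; [rewrite !partial0|exact: dom].
pose E l := partial beta l - partial alpha l.
have [E0|[l0 El0]] : (forall l : 'I_m.+1, E l = 0) \/ exists l : 'I_m.+1, 0 < E l.
- have [/existsP[l El]|/existsPn h] := boolP [exists l : 'I_m.+1, 0 < E l].
    by right; exists l.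
  by left=> l; apply/eqP; rewrite -leqn0 leqNgt.
- suff -> : beta = alpha by [].
  apply: funext => t.
  have := partialS alpha t; have := partialS beta t.
  have := E0 (inord t); have := E0 (inord t.+1); rewrite /E.
  have tm := ltn_ord t.
  rewrite !inordK//; last by lia.
  by have := dom t (ltnW tm); have := dom t.+1 tm; lia.
(* At the first maximum [l] of the excess [E], [beta] drops from [l.-1] to [l]. *)
have exM : exists l, (l <= m) && [forall l' : 'I_m.+1, E l' <= E l].
  case: (@arg_maxnP _ l0 xpredT (fun l : 'I_m.+1 => E l) isT) => l _ hl.
  by exists l; rewrite -ltnS ltn_ord /=; apply/forallP => l'; exact: hl.
case: (ex_minnP exM) => l /andP[lm /forallP lmax] lmin.
have {}lmax l' : l' <= m -> E l' <= E l.
  by move=> l'm; have := lmax (inord l'); rewrite inordK.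
have El : 0 < E l by apply: leq_trans El0 (lmax _ _); rewrite -ltnS.
have l_gt0 : 0 < l by case: l El {lm lmax lmin} => //; rewrite /E !partial0.
have lm' : l < m.
  rewrite ltn_neqAle lm andbT; apply: contraL El => /eqP ->.
  by rewrite /E !partial_weight wE subnn.
have Elt : E l.-1 < E l.
  rewrite ltnNge; apply/negP => h; suff /lmin : (l.-1 <= m) &&
      [forall l' : 'I_m.+1, E l' <= E l.-1] by lia.
  apply/andP; split; first by lia.
  by apply/forallP => l'; apply: leq_trans h; apply: lmax; rewrite -ltnS.
pose j := Ordinal lm'; have im : l.-1 < m by lia.
pose i := Ordinal im; have ij : j = i.+1 :> nat by rewrite /= prednK.
(* The excess rises into [l] and does not rise after it, so with [alpha] sorted
   [beta j <= alpha j <= alpha i < beta i], and a unit can be moved from [i] to [j]. *)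
have bi : alpha i < beta i.
  have := partialS alpha i; have := partialS beta i; rewrite -ij /=.
  by move: Elt; rewrite /E; have := dom l lm; have := dom l.-1 (ltnW im); lia.
have bj : beta j <= alpha j.
  have := partialS alpha j; have := partialS beta j; rewrite /=.
  by have := lmax l.+1 lm'; rewrite /E; have := dom l lm; have := dom l.+1 lm'; lia.
have aij : alpha j <= alpha i by apply: anoninc; rewrite ij.
have nij : (i == j) = false by rewrite -val_eqE /= ; lia.
pose beta' t := beta t + (t == j) - (t == i).
have bE t : beta' t + (t == i) = beta t + (t == j).
  by rewrite /beta'; have [->|ti] := eqVneq t i; [lia|rewrite subn0 addn0].
have pE l' : partial beta' l' + (l == l') = partial beta l'.
  have : partial (fun t => beta' t + (t == i)) l' = partial (fun t => beta t + (t == j)) l'.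
    by congr partial; apply: funext.
  by rewrite !partialD !partial_unit /=; lia.
apply: leq_trans (IH beta' _ _ _).
- by apply/D_le_card/(matrices_transfer_le k n_gt0 ij bE); lia.
- have sumE : \sum_(l' < m.+1) partial beta l' =
              \sum_(l' < m.+1) partial beta' l' + \sum_(l' < m.+1) (l == l').
    by rewrite -big_split; apply: eq_bigr => l' _; rewrite /= pE.
  apply: leq_trans leN; rewrite sumE -[ltnLHS]addn0 ltn_add2l.
  by rewrite (bigD1 (Ordinal (lm : l < m.+1)))//= eqxx.
(* Only the partial sum at [l] drops, and the excess there is positive, so dominance persists. *)
- move=> l' /andP[_ l'm]; change (partial alpha l' <= partial beta' l').
  have := pE l'; have [<-|_] := eqVneq l l'; last by have := dom l' l'm; lia.
  by move: El; rewrite /E; lia.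
- rewrite wE -!partial_weight -(pE m); lia.
Qed.

Theorem theorem8p1 (k n m : nat) (hk : 1 <= k) (hn : 1 <= n) (hm : 1 <= m) :
  (forall (alpha : 'I_m -> nat) (s : 'S_m),
     D k n (fun t => alpha (s t)) = D k n alpha)
  /\
  (forall alpha beta : 'I_m -> nat,
     nonincreasing alpha ->
     dominates beta alpha -> weight alpha = weight beta ->
     D k n beta <= D k n alpha).
Proof.
split=> [alpha s|alpha beta anoninc dom wE]; first exact: D_perm.
exact: D_dominance.
Qed.
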